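(* A monoidal category $\mathbf{D}$ is cartesian if and only if there exists a braided monoidal category $\mathbf{C}$ such that (1) $\mathbf{D}$ is a monoidal subcategory of the category $\mathrm{Com}(\mathbf{C})$ of comonoids in $\mathbf{C}$, and (2) the counit and the comultiplication of every object of $\mathbf{D}$ are morphisms in $\mathbf{D}$. In this case, the canonical symmetry of $\mathbf{D}$ is the restriction of the braiding of $\mathbf{C}$, and all comonoids in $\mathbf{D}$ (i.e. all objects of $\mathbf{D}$, viewed as comonoids in $\mathbf{C}$) are cocommutative.
   Context: All monoidal categories are assumed strict. A braiding on $\mathbf{C}$ is a natural isomorphism $\sigma_{X,Y}\colon X\otimes Y\to Y\otimes X$ with $\sigma_{X\otimes Y,Z}=(\sigma_{X,Z}\otimes\mathrm{id}_Y)\circ(\mathrm{id}_X\otimes\sigma_{Y,Z})$ and $\sigma_{X,Y\otimes Z}=(\mathrm{id}_Y\otimes\sigma_{X,Z})\circ(\sigma_{X,Y}\otimes\mathrm{id}_Z)$; it is a symmetry if $\sigma_{Y,X}\circ\sigma_{X,Y}=\mathrm{id}_{X\otimes Y}$ for all $X,Y$. A comonoid in $\mathbf{C}$ is an object $X$ with morphisms $\Delta_X\colon X\to X\otimes X$ (comultiplication) and $\varepsilon_X\colon X\to\mathbf{1}$ (counit) such that $(\mathrm{id}_X\otimes\varepsilon_X)\circ\Delta_X=\mathrm{id}_X=(\varepsilon_X\otimes\mathrm{id}_X)\circ\Delta_X$ and $(\Delta_X\otimes\mathrm{id}_X)\circ\Delta_X=(\mathrm{id}_X\otimes\Delta_X)\circ\Delta_X$.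 It is cocommutative if $\sigma_{X,X}\circ\Delta_X=\Delta_X$. A morphism of comonoids is a morphism $f\colon X\to Y$ in $\mathbf{C}$ with $\Delta_Y\circ f=(f\otimes f)\circ\Delta_X$ and $\varepsilon_Y\circ f=\varepsilon_X$. The category $\mathrm{Com}(\mathbf{C})$ is monoidal: $X\otimes Y$ carries $\varepsilon_{X\otimes Y}=\varepsilon_X\otimes\varepsilon_Y$ and $\Delta_{X\otimes Y}=(\mathrm{id}_X\otimes\sigma_{X,Y}\otimes\mathrm{id}_Y)\circ(\Delta_X\otimes\Delta_Y)$, and the unit object is $\mathbf{1}$ with identity structure maps. A monoidal subcategory is a (not necessarily full) subcategory containing the unit object and closed under $\otimes$ on objects and morphisms, with the inherited monoidal structure; ''$\mathbf{D}$ is a monoidal subcategory of $\mathrm{Com}(\mathbf{C})$'' is understood up to identifying $\mathbf{D}$ with such a subcategory via a strict monoidal isomorphism. A monoidal category is cartesian if its unit object $\mathbf{1}$ is terminal and, writing $\varepsilon_X\colon X\to\mathbf{1}$ for the unique morphism, for all objects $X,Y$ the object $X\otimes Y$ together with $\pi^1_{XY}=\mathrm{id}_X\otimes\varepsilon_Y$ and $\pi^2_{XY}=\varepsilon_X\otimes\mathrm{id}_Y$ is a categorical product of $X$ and $Y$. The canonical symmetry of a cartesian category is the natural transformation $X\otimes Y\to Y\otimes X$ given by the unique morphism whose composites with $\pi^1_{YX}$ and $\pi^2_{YX}$ are $\pi^2_{XY}$ and $\pi^1_{XY}$, respectively. *)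

(* Defs.v *)
From mathcomp Require Import ssreflect ssrfun boolp.

Set Implicit Arguments.
Unset Strict Implicit.
Unset Printing Implicit Defensive.

Declare Scope moncat_scope.
Delimit Scope moncat_scope with mc.
Local Open Scope moncat_scope.

Reserved Notation "g ∘ f" (at level 40, left associativity).
Reserved Notation "X ⊗ Y" (at level 39, left associativity).
Reserved Notation "f ⊗₁ g" (at level 39, left associativity).

Record category := Category {
  ob :> Type;
  hom : ob -> ob -> Type;
  idm : forall X, hom X X;
  compm : forall X Y Z, hom Y Z -> hom X Y -> hom X Z;
  comp1m : forall X Y (f : hom X Y), compm (idm Y) f = f;
  compm1 : forall X Y (f : hom X Y), compm f (idm X) = f;
  compmA : forall X Y Z W (h : hom Z W) (g : hom Y Z) (f : hom X Y),
    compm h (compm g f) = compm (compm h g) f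
}.
Arguments idm {c} X.
Notation "g ∘ f" := (compm g f) : moncat_scope.

(* Arr f = Arr g states that f and g are equal morphisms when their endpoints
   are equal, but not necessarily convertible, objects (as happens all the time
   in a strict monoidal category); hcast retypes a morphism along such
   equalities and does not change Arr (Arr_hcast). *)
Record arrow (C : category) := Arr { src : C; tgt : C; mor : hom src tgt }.

Definition hcast (C : category) (X X' Y Y' : C) (eX : X = X') (eY : Y = Y')
  (f : hom X Y) : hom X' Y' :=
  match eX in _ = A, eY in _ = B return hom A B with
  | erefl, erefl => f
  end.

Lemma Arr_hcast (C : category) (X X' Y Y' : C) (eX : X = X') (eY : Y = Y')
  (f : hom X Y) : Arr (hcast eX eY f) = Arr f.
Proof. by case: _ / eX; case: _ / eY. Qed.

Lemma Arr_inj (C : category) (X Y : C) (f g : hom X Y) : Arr f = Arr g -> f = g.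
Proof.
suff H (a b : arrow C) (e : a = b) :
    mor b = hcast (f_equal (@src C) e) (f_equal (@tgt C) e) (mor a).
  move=> e; have /= -> := H _ _ e.
  by rewrite (Prop_irrelevance (f_equal (@src C) e) erefl)
             (Prop_irrelevance (f_equal (@tgt C) e) erefl).
by case: _ / e.
Qed.

Definition is_iso (C : category) (X Y : C) (f : hom X Y) : Prop :=
  exists g : hom Y X, g ∘ f = idm X /\ f ∘ g = idm Y.

Definition is_terminal (C : category) (T : C) : Prop :=
  forall X : C, exists! f : hom X T, True.

Definition is_product (C : category) (X Y P : C) (p : hom P X) (q : hom P Y) :
    Prop :=
  forall (Z : C) (f : hom Z X) (g : hom Z Y),
    exists! h : hom Z P, p ∘ h = f /\ q ∘ h = g.

Record monoidal := Monoidal {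
  mcat :> category;
  unit_ob : mcat;
  tens : mcat -> mcat -> mcat;
  tensm : forall X X' Y Y' : mcat,
    hom X X' -> hom Y Y' -> hom (tens X Y) (tens X' Y');
  tensm_id : forall X Y : mcat, tensm (idm X) (idm Y) = idm (tens X Y);
  tensm_comp : forall (X X' X'' Y Y' Y'' : mcat)
      (f' : hom X' X'') (f : hom X X') (g' : hom Y' Y'') (g : hom Y Y'),
    tensm (f' ∘ f) (g' ∘ g) = tensm f' g' ∘ tensm f g;
  tensA : forall X Y Z : mcat, tens X (tens Y Z) = tens (tens X Y) Z;
  tens1l : forall X : mcat, tens unit_ob X = X;
  tens1r : forall X : mcat, tens X unit_ob = X;
  tensmA : forall (X X' Y Y' Z Z' : mcat)
      (f : hom X X') (g : hom Y Y') (h : hom Z Z'),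
    Arr (tensm f (tensm g h)) = Arr (tensm (tensm f g) h);
  tensm1l : forall (X Y : mcat) (f : hom X Y),
    Arr (tensm (idm unit_ob) f) = Arr f;
  tensm1r : forall (X Y : mcat) (f : hom X Y),
    Arr (tensm f (idm unit_ob)) = Arr f
}.
Arguments unit_ob {m}.
Notation "𝟙" := unit_ob : moncat_scope.
Notation "X ⊗ Y" := (tens X Y) : moncat_scope.
Notation "f ⊗₁ g" := (tensm f g) : moncat_scope.

Record braided := Braided {
  bcat :> monoidal;
  braid : forall X Y : bcat, hom (X ⊗ Y) (Y ⊗ X);
  braid_iso : forall X Y : bcat, is_iso (braid X Y);
  braid_nat : forall (X X' Y Y' : bcat) (f : hom X X') (g : hom Y Y'),
    braid X' Y' ∘ (f ⊗₁ g) = (g ⊗₁ f) ∘ braid X Y;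
  braid_tensl : forall X Y Z : bcat,
    Arr (braid (X ⊗ Y) Z) =
    Arr ((braid X Z ⊗₁ idm Y) ∘
         hcast erefl (tensA X Z Y) (idm X ⊗₁ braid Y Z));
  braid_tensr : forall X Y Z : bcat,
    Arr (braid X (Y ⊗ Z)) =
    Arr ((idm Y ⊗₁ braid X Z) ∘
         hcast erefl (esym (tensA Y X Z)) (braid X Y ⊗₁ idm Z))
}.

Record monoidal_functor (C D : monoidal) := MonoidalFunctor {
  fob :> C -> D;
  fhom : forall X Y : C, hom X Y -> hom (fob X) (fob Y);
  fhom_id : forall X : C, fhom (idm X) = idm (fob X);
  fhom_comp : forall (X Y Z : C) (g : hom Y Z) (f : hom X Y),
    fhom (g ∘ f) = fhom g ∘ fhom f;
  fob_unit : fob 𝟙 = 𝟙;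
  fob_tens : forall X Y : C, fob (X ⊗ Y) = fob X ⊗ fob Y;
  fhom_tens : forall (X X' Y Y' : C) (f : hom X X') (g : hom Y Y'),
    Arr (fhom (f ⊗₁ g)) = Arr (fhom f ⊗₁ fhom g)
}.

Record monoidal_iso (C D : monoidal) := MonoidalIso {
  iso_fun :> monoidal_functor C D;
  iso_inv : monoidal_functor D C;
  iso_funK : forall (X Y : C) (f : hom X Y),
    Arr (fhom iso_inv (fhom iso_fun f)) = Arr f;
  iso_invK : forall (X Y : D) (f : hom X Y),
    Arr (fhom iso_fun (fhom iso_inv f)) = Arr f
}.

Record monoidal_subcat (M : monoidal) := MonoidalSubcat {
  sub_ob : M -> Prop;
  sub_hom : forall X Y : M, hom X Y -> Prop;
  sub_hom_src : forall (X Y : M) (f : hom X Y), sub_hom f -> sub_ob X;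
  sub_hom_tgt : forall (X Y : M) (f : hom X Y), sub_hom f -> sub_ob Y;
  sub_id : forall X : M, sub_ob X -> sub_hom (idm X);
  sub_comp : forall (X Y Z : M) (g : hom Y Z) (f : hom X Y),
    sub_hom g -> sub_hom f -> sub_hom (g ∘ f);
  sub_unit : sub_ob 𝟙;
  sub_tens : forall X Y : M, sub_ob X -> sub_ob Y -> sub_ob (X ⊗ Y);
  sub_tensm : forall (X X' Y Y' : M) (f : hom X X') (g : hom Y Y'),
    sub_hom f -> sub_hom g -> sub_hom (f ⊗₁ g)
}.

Section Subcat.
Variables (M : monoidal) (S : monoidal_subcat M).

Let sob := {X : M | sub_ob S X}.
Let shom (X Y : sob) := {f : hom (sval X) (sval Y) | sub_hom S f}.

Lemma sval_inj (T : Type) (P : T -> Prop) (x y : {x | P x}) :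
  sval x = sval y -> x = y.
Proof. by case: x y => [x Px] [y Py] /= e; apply: eq_exist. Qed.

Definition subcat_category : category.
Proof.
refine (@Category sob shom
  (fun X => exist _ (idm (sval X)) (sub_id (proj2_sig X)))
  (fun X Y Z g f => exist _ (sval g ∘ sval f)
     (sub_comp (proj2_sig g) (proj2_sig f))) _ _ _).
- by move=> X Y f; apply: sval_inj; apply: comp1m.
- by move=> X Y f; apply: sval_inj; apply: compm1.
- by move=> X Y Z W h g f; apply: sval_inj; apply: compmA.
Defined.

Lemma Arr_subcat (X Y X' Y' : subcat_category) (f : hom X Y) (g : hom X' Y') :
  Arr (sval f) = Arr (sval g) -> Arr f = Arr g.
Proof.
move=> e; have eX : X = X' by apply: sval_inj; exact: (f_equal (@src M) e).
have eY : Y = Y' by apply: sval_inj; exact: (f_equal (@tgt M) e).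
case: _ / eX g e => g; case: _ / eY g => g e.
by congr Arr; apply: sval_inj; apply: Arr_inj.
Qed.

Definition subcat : monoidal.
Proof.
refine (@Monoidal subcat_category
  (exist _ 𝟙 (sub_unit S))
  (fun X Y => exist _ (sval X ⊗ sval Y)
     (sub_tens (proj2_sig X) (proj2_sig Y)))
  (fun X X' Y Y' f g => exist _ (sval f ⊗₁ sval g)
     (sub_tensm (proj2_sig f) (proj2_sig g))) _ _ _ _ _ _ _ _).
- by move=> X Y; apply: sval_inj; apply: tensm_id.
- by move=> *; apply: sval_inj; apply: tensm_comp.
- by move=> X Y Z; apply: sval_inj; apply: tensA.
- by move=> X; apply: sval_inj; apply: tens1l.
- by move=> X; apply: sval_inj; apply: tens1r.
- by move=> *; apply: Arr_subcat; apply: tensmA.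
- by move=> *; apply: Arr_subcat; apply: tensm1l.
- by move=> *; apply: Arr_subcat; apply: tensm1r.
Defined.

End Subcat.

(* Composition, tensor product and identities on the type of all arrows, where
   the laws of a strict monoidal category are plain equalities. The value of
   acomp g f is irrelevant if f and g are not composable. *)

Section ArrowCalculus.
Variable C : monoidal.
Implicit Types (a b c : arrow C) (X Y Z : C).

Definition aid X : arrow C := Arr (idm X).

Definition acomp b a : arrow C :=
  match pselect (tgt a = src b) with
  | left e => Arr (mor b ∘ hcast erefl e (mor a))
  | right _ => a
  end.

Definition atens a b : arrow C := Arr (mor a ⊗₁ mor b).

Lemma Arr_comp X Y Z (g : hom Y Z) (f : hom X Y) :
  Arr (g ∘ f) = acomp (Arr g) (Arr f).
Proof.
rewrite /acomp; case: pselect => //= e.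
by rewrite (Prop_irrelevance e erefl).
Qed.

Lemma Arr_tens X X' Y Y' (f : hom X X') (g : hom Y Y') :
  Arr (f ⊗₁ g) = atens (Arr f) (Arr g).
Proof. by []. Qed.

Lemma src_acomp b a : src (acomp b a) = src a.
Proof. by rewrite /acomp; case: pselect. Qed.

Lemma tgt_acomp b a : tgt a = src b -> tgt (acomp b a) = tgt b.
Proof. by rewrite /acomp; case: pselect. Qed.

Lemma acomp1m a X : tgt a = X -> acomp (aid X) a = a.
Proof. by case: a => Y Z f /= <-; rewrite -Arr_comp comp1m. Qed.

Lemma acompm1 a X : src a = X -> acomp a (aid X) = a.
Proof. by case: a => Y Z f /= <-; rewrite -Arr_comp compm1. Qed.

Lemma acompA c b a : tgt a = src b -> tgt b = src c ->
  acomp c (acomp b a) = acomp (acomp c b) a.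
Proof.
case: a b c => X Y f [Y' Z g] [Z' W h] /= eY eZ.
case: _ / eY g => g; case: _ / eZ h => h.
by rewrite -!Arr_comp compmA.
Qed.

Lemma atens_comp b a b' a' : tgt a = src b -> tgt a' = src b' ->
  atens (acomp b a) (acomp b' a') = acomp (atens b b') (atens a a').
Proof.
case: a b => X Y f [U Z g] /= e; case: _ / e g => g.
case: a' b' => X' Y' f' [U' Z' g'] /= e; case: _ / e g' => g'.
by rewrite -!Arr_comp -Arr_tens tensm_comp.
Qed.

Lemma atensA a b c : atens a (atens b c) = atens (atens a b) c.
Proof. exact: tensmA. Qed.

Lemma atens1l a : atens (aid 𝟙) a = a.
Proof. by case: a => X Y f; apply: tensm1l. Qed.

Lemma atens1r a : atens a (aid 𝟙) = a.
Proof. by case: a => X Y f; apply: tensm1r. Qed.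

Lemma aid_tens X Y : aid (X ⊗ Y) = atens (aid X) (aid Y).
Proof. by rewrite /aid -tensm_id. Qed.

Lemma atens_compl b a X : tgt a = src b ->
  atens (acomp b a) (aid X) = acomp (atens b (aid X)) (atens a (aid X)).
Proof. by move=> e; rewrite -atens_comp // acomp1m. Qed.

Lemma atens_compr b a X : tgt a = src b ->
  atens (aid X) (acomp b a) = acomp (atens (aid X) b) (atens (aid X) a).
Proof. by move=> e; rewrite -atens_comp // acomp1m. Qed.

End ArrowCalculus.

Ltac endpoints :=
  rewrite /= ?src_acomp /=;
  repeat (rewrite tgt_acomp; last (by endpoints));
  rewrite /= ?tensA ?tens1l ?tens1r; reflexivity.

Section Braiding.
Variable C : braided.
Implicit Types (a b : arrow C) (X Y Z : C).

Definition abraid X Y : arrow C := Arr (braid X Y).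

Lemma abraid_nat a b (X := src a) (X' := tgt a) (Y := src b) (Y' := tgt b) :
  acomp (abraid X' Y') (atens a b) = acomp (atens b a) (abraid X Y).
Proof.
rewrite {}/X {}/X' {}/Y {}/Y'; case: a b => X X' f [Y Y' g].
by rewrite -!Arr_tens -!Arr_comp braid_nat.
Qed.

Lemma abraid_tensl X Y Z :
  abraid (X ⊗ Y) Z = acomp (atens (abraid X Z) (aid Y)) (atens (aid X) (abraid Y Z)).
Proof. by rewrite /abraid braid_tensl Arr_comp Arr_hcast. Qed.

Lemma abraid_tensr X Y Z :
  abraid X (Y ⊗ Z) = acomp (atens (aid Y) (abraid X Z)) (atens (abraid X Y) (aid Z)).
Proof. by rewrite /abraid braid_tensr Arr_comp Arr_hcast. Qed.

Lemma abraid_idem X Y :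
  X ⊗ Y = Y ⊗ X -> abraid X Y = acomp (abraid X Y) (abraid X Y) ->
  abraid X Y = aid (X ⊗ Y).
Proof.
move=> e idem; have [g [gK _]] := braid_iso X Y.
have {}gK : acomp (Arr g) (abraid X Y) = aid (X ⊗ Y).
  by rewrite -Arr_comp gK.
rewrite -[RHS]gK {2}idem acompA // gK acomp1m //.
Qed.

Lemma abraid1l X : abraid 𝟙 X = aid X.
Proof.
rewrite -[in RHS](tens1l X); apply: abraid_idem; first by rewrite tens1l tens1r.
by have := abraid_tensl 𝟙 𝟙 X; rewrite tens1l atens1l atens1r.
Qed.

Lemma abraid1r X : abraid X 𝟙 = aid X.
Proof.
rewrite -[in RHS](tens1r X); apply: abraid_idem; first by rewrite tens1l tens1r.
by have := abraid_tensr X 𝟙 𝟙; rewrite tens1l atens1l atens1r.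
Qed.

End Braiding.

Record comonoid (C : monoidal) := Comonoid {
  carrier :> C;
  comult : hom carrier (carrier ⊗ carrier);
  counit : hom carrier 𝟙;
  counit_r : Arr ((idm carrier ⊗₁ counit) ∘ comult) = Arr (idm carrier);
  counit_l : Arr ((counit ⊗₁ idm carrier) ∘ comult) = Arr (idm carrier);
  comultA : Arr ((comult ⊗₁ idm carrier) ∘ comult) =
            Arr ((idm carrier ⊗₁ comult) ∘ comult)
}.
Arguments comult {C} X : rename.
Arguments counit {C} X : rename.

Definition cocommutative (C : braided) (X : comonoid C) : Prop :=
  braid X X ∘ comult X = comult X.

Definition is_comonoid_hom (C : monoidal) (X Y : comonoid C) (f : hom X Y) :
    Prop :=
  comult Y ∘ f = (f ⊗₁ f) ∘ comult X /\ counit Y ∘ f = counit X.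

Definition comonoid_hom (C : monoidal) (X Y : comonoid C) :=
  {f : hom X Y | is_comonoid_hom f}.

Lemma comonoid_eq (C : monoidal) (X Y : comonoid C) :
  Arr (comult X) = Arr (comult Y) -> Arr (counit X) = Arr (counit Y) -> X = Y.
Proof.
case: X Y => [X d e p q r] [Y d' e' p' q' r'] /= Ed.
have eX : X = Y := f_equal (@src C) Ed.
case: _ / eX d' e' p' q' r' Ed => d' e' p' q' r' /Arr_inj Ed /Arr_inj Ee.
case: _ / Ed p' q' r'; case: _ / Ee => p' q' r'.
by congr Comonoid; apply: Prop_irrelevance.
Qed.

Section Com.
Variable C : braided.

Lemma tens_exchange (X Y Z W : C) : X ⊗ (Y ⊗ Z) ⊗ W = (X ⊗ Y) ⊗ (Z ⊗ W).
Proof. by rewrite !tensA. Qed.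

Definition tens_comult (X Y : comonoid C) : hom (X ⊗ Y) ((X ⊗ Y) ⊗ (X ⊗ Y)) :=
  hcast (tens_exchange X X Y Y) (tens_exchange X Y X Y)
        (idm X ⊗₁ braid X Y ⊗₁ idm Y) ∘ (comult X ⊗₁ comult Y).

Definition tens_counit (X Y : comonoid C) : hom (X ⊗ Y) 𝟙 :=
  hcast erefl (tens1l 𝟙) (counit X ⊗₁ counit Y).

Local Notation s := (@abraid C).
Local Notation "f * g" := (atens f g).
Local Notation "g ∙ f" := (acomp g f) (at level 45, left associativity).
Local Notation "1_ X" := (aid X) (at level 8, X at level 2, format "1_ X").
Local Notation d X := (Arr (comult X)).
Local Notation e X := (Arr (counit X)).

Lemma Arr_tens_comult (X Y : comonoid C) :
  Arr (tens_comult X Y) = 1_X * s X Y * 1_Y ∙ d X * d Y.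
Proof. by rewrite /tens_comult Arr_comp Arr_hcast. Qed.

Lemma Arr_tens_counit (X Y : comonoid C) : Arr (tens_counit X Y) = e X * e Y.
Proof. by rewrite /tens_counit Arr_hcast. Qed.

Lemma aunit_r (X : comonoid C) : 1_X * e X ∙ d X = 1_X.
Proof. by rewrite -Arr_tens -Arr_comp counit_r. Qed.

Lemma aunit_l (X : comonoid C) : e X * 1_X ∙ d X = 1_X.
Proof. by rewrite -Arr_tens -Arr_comp counit_l. Qed.

Lemma acomultA (X : comonoid C) : d X * 1_X ∙ d X = 1_X * d X ∙ d X.
Proof. by rewrite -!Arr_tens -!Arr_comp comultA. Qed.

Lemma atens3_comp (a1 b1 a2 b2 a3 b3 : arrow C) :
  tgt a1 = src b1 -> tgt a2 = src b2 -> tgt a3 = src b3 ->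
  b1 * b2 * b3 ∙ a1 * a2 * a3 = (b1 ∙ a1) * (b2 ∙ a2) * (b3 ∙ a3).
Proof. by move=> e1 e2 e3; rewrite -!atens_comp //=; congr tens. Qed.

Lemma tens_counit_r (X Y : comonoid C) :
  Arr ((idm (X ⊗ Y) ⊗₁ tens_counit X Y) ∘ tens_comult X Y) = Arr (idm (X ⊗ Y)).
Proof.
rewrite Arr_comp Arr_tens Arr_tens_comult Arr_tens_counit -!/(aid _) !aid_tens.
rewrite acompA; [|endpoints|endpoints].
have -> : 1_X * 1_Y * (e X * e Y) = 1_X * (1_Y * e X) * e Y by rewrite !atensA.
rewrite atens3_comp; [|endpoints|endpoints|endpoints].
have := abraid_nat (e X) 1_Y; rewrite /= abraid1l acomp1m; last by endpoints.
move=> <-; rewrite acomp1m // acompm1 //.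
have -> : 1_X * (e X * 1_Y) * e Y = (1_X * e X) * (1_Y * e Y) by rewrite !atensA.
by rewrite -atens_comp // !aunit_r.
Qed.

Lemma tens_counit_l (X Y : comonoid C) :
  Arr ((tens_counit X Y ⊗₁ idm (X ⊗ Y)) ∘ tens_comult X Y) = Arr (idm (X ⊗ Y)).
Proof.
rewrite Arr_comp Arr_tens Arr_tens_comult Arr_tens_counit -!/(aid _) !aid_tens.
rewrite acompA; [|endpoints|endpoints].
have -> : e X * e Y * (1_X * 1_Y) = e X * (e Y * 1_X) * 1_Y by rewrite !atensA.
rewrite atens3_comp; [|endpoints|endpoints|endpoints].
have := abraid_nat 1_X (e Y); rewrite /= abraid1r acomp1m; last by endpoints.
move=> <-; rewrite acomp1m // acompm1 //.
have -> : e X * (1_X * e Y) * 1_Y = (e X * 1_X) * (e Y * 1_Y) by rewrite !atensA.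
by rewrite -atens_comp // !aunit_l.
Qed.

Lemma tens_comultA (X Y : comonoid C) :
  Arr ((tens_comult X Y ⊗₁ idm (X ⊗ Y)) ∘ tens_comult X Y) =
  Arr ((idm (X ⊗ Y) ⊗₁ tens_comult X Y) ∘ tens_comult X Y).
Proof.
rewrite [LHS]Arr_comp [RHS]Arr_comp !Arr_tens !Arr_tens_comult.
rewrite -!/(aid _) !aid_tens.
pose sl := 1_X * s X Y * (1_Y * 1_X * 1_Y).
pose sr := 1_X * 1_Y * 1_X * s X Y * 1_Y.
have -> : (1_X * s X Y * 1_Y ∙ d X * d Y) * (1_X * 1_Y) =
          sl ∙ d X * (d Y * 1_X) * 1_Y.
  rewrite -aid_tens atens_compl; last by endpoints.
  by rewrite /sl aid_tens !atensA.
have -> : (1_X * 1_Y) * (1_X * s X Y * 1_Y ∙ d X * d Y) =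
          sr ∙ 1_X * (1_Y * d X) * d Y.
  rewrite -aid_tens atens_compr; last by endpoints.
  by rewrite /sr aid_tens !atensA.
have -> : sl ∙ d X * (d Y * 1_X) * 1_Y ∙ (1_X * s X Y * 1_Y ∙ d X * d Y) =
    sl ∙ (1_X * 1_X) * s X (Y ⊗ Y) * 1_Y ∙ ((d X * 1_X ∙ d X) * (d Y * 1_Y ∙ d Y)).
  rewrite atens_comp // -!acompA; try endpoints.
  congr acomp; rewrite !acompA; try endpoints.
  congr acomp; rewrite atens3_comp; try endpoints.
  have := abraid_nat 1_X (d Y) => /= <-.
  have -> : d X * 1_X * (d Y * 1_Y) = d X * (1_X * d Y) * 1_Y by rewrite !atensA.
  rewrite atens3_comp; try endpoints.
  by rewrite -aid_tens !acomp1m // acompm1.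
have -> : sr ∙ 1_X * (1_Y * d X) * d Y ∙ (1_X * s X Y * 1_Y ∙ d X * d Y) =
    sr ∙ 1_X * s (X ⊗ X) Y * (1_Y * 1_Y) ∙ ((1_X * d X ∙ d X) * (1_Y * d Y ∙ d Y)).
  rewrite atens_comp // -!acompA; try endpoints.
  congr acomp; rewrite !acompA; try endpoints.
  congr acomp; rewrite atens3_comp; try endpoints.
  have := abraid_nat (d X) 1_Y => /= <-.
  have -> : 1_X * d X * (1_Y * d Y) = 1_X * (d X * 1_Y) * d Y by rewrite !atensA.
  rewrite atens3_comp; try endpoints.
  by rewrite -aid_tens !acomp1m // acompm1.
rewrite !acomultA; congr acomp.
rewrite abraid_tensl abraid_tensr.
have -> : 1_X * 1_X * (1_Y * s X Y ∙ s X Y * 1_Y) * 1_Y =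
          (1_X * 1_X * 1_Y) * s X Y * 1_Y ∙ 1_X * (1_X * s X Y * 1_Y) * 1_Y.
  rewrite -aid_tens atens_compr ?atens_compl; try endpoints.
  by rewrite aid_tens !atensA.
have -> : 1_X * (s X Y * 1_X ∙ 1_X * s X Y) * (1_Y * 1_Y) =
          1_X * s X Y * (1_X * 1_Y * 1_Y) ∙ 1_X * (1_X * s X Y * 1_Y) * 1_Y.
  rewrite -aid_tens atens_compr ?atens_compl; try endpoints.
  by rewrite aid_tens !atensA.
rewrite !acompA; try endpoints.
congr acomp; rewrite /sl /sr.
transitivity (1_X * s X Y * s X Y * 1_Y).
- have -> : 1_X * s X Y * (1_Y * 1_X * 1_Y) = 1_X * s X Y * (1_Y * 1_X) * 1_Y.
    by rewrite !atensA.
  have -> : 1_X * 1_X * 1_Y * s X Y * 1_Y = 1_X * (1_X * 1_Y) * s X Y * 1_Y.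
    by rewrite !atensA.
  rewrite -!aid_tens -!atens_comp; try endpoints.
  by rewrite !acomp1m // !acompm1.
- have -> : 1_X * s X Y * (1_X * 1_Y * 1_Y) = 1_X * s X Y * (1_X * 1_Y) * 1_Y.
    by rewrite !atensA.
  have -> : 1_X * 1_Y * 1_X * s X Y * 1_Y = 1_X * (1_Y * 1_X) * s X Y * 1_Y.
    by rewrite !atensA.
  rewrite -!aid_tens -!atens_comp; try endpoints.
  by rewrite !acomp1m // !acompm1.
Qed.

Lemma tens_is_comonoid_hom (X X' Y Y' : comonoid C) (f : hom X X') (g : hom Y Y') :
  is_comonoid_hom f -> is_comonoid_hom g ->
  tens_comult X' Y' ∘ (f ⊗₁ g) =
    ((f ⊗₁ g) ⊗₁ (f ⊗₁ g)) ∘ tens_comult X Y /\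
  tens_counit X' Y' ∘ (f ⊗₁ g) = tens_counit X Y.
Proof.
move=> [fd fe] [gd ge]; split; apply: Arr_inj; last first.
  rewrite Arr_comp !Arr_tens_counit Arr_tens -atens_comp // -!Arr_comp.
  by rewrite fe ge.
rewrite [LHS]Arr_comp [RHS]Arr_comp !Arr_tens_comult !Arr_tens.
rewrite -acompA; [|endpoints|endpoints].
rewrite -atens_comp // -!Arr_comp fd gd !Arr_comp.
rewrite atens_comp // acompA; [|endpoints|endpoints].
rewrite acompA; [|endpoints|endpoints].
congr acomp.
have -> : Arr f * Arr g * (Arr f * Arr g) = Arr f * (Arr g * Arr f) * Arr g.
  by rewrite !atensA.
have -> : Arr (f ⊗₁ f) * Arr (g ⊗₁ g) = Arr f * (Arr f * Arr g) * Arr g.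
  by rewrite !Arr_tens !atensA.
rewrite !atens3_comp //; have := abraid_nat (Arr f) (Arr g) => /= <-.
by rewrite !acomp1m // !acompm1.
Qed.

Lemma id_is_comonoid_hom (X : comonoid C) : is_comonoid_hom (idm X : hom X X).
Proof. by split; rewrite ?tensm_id ?compm1 ?comp1m. Qed.

Lemma comp_is_comonoid_hom (X Y Z : comonoid C) (g : hom Y Z) (f : hom X Y) :
  is_comonoid_hom g -> is_comonoid_hom f ->
  is_comonoid_hom (g ∘ f : hom X Z).
Proof.
move=> [gd ge] [fd fe]; split; last by rewrite compmA ge.
by rewrite compmA gd -compmA fd compmA -tensm_comp.
Qed.

Definition com_category : category.
Proof.
refine (@Category (comonoid C) (@comonoid_hom C)
  (fun X => exist _ (idm (carrier X)) (id_is_comonoid_hom X))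
  (fun X Y Z g f => exist _ (sval g ∘ sval f)
     (comp_is_comonoid_hom (proj2_sig g) (proj2_sig f))) _ _ _).
- by move=> X Y f; apply: sval_inj; apply: comp1m.
- by move=> X Y f; apply: sval_inj; apply: compm1.
- by move=> X Y Z W h g f; apply: sval_inj; apply: compmA.
Defined.

Definition unit_comonoid : comonoid C.
Proof.
refine (@Comonoid C 𝟙 (hcast erefl (esym (tens1l 𝟙)) (idm 𝟙)) (idm 𝟙) _ _ _).
- by rewrite Arr_comp Arr_hcast Arr_tens atens1l acomp1m.
- by rewrite Arr_comp Arr_hcast Arr_tens atens1l acomp1m.
- by rewrite [LHS]Arr_comp [RHS]Arr_comp !Arr_tens !Arr_hcast.
Defined.

Definition tens_comonoid (X Y : comonoid C) : comonoid C :=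
  Comonoid (tens_counit_r X Y) (tens_counit_l X Y) (tens_comultA X Y).

Lemma tens_comonoidA (X Y Z : comonoid C) :
  tens_comonoid X (tens_comonoid Y Z) = tens_comonoid (tens_comonoid X Y) Z.
Proof.
apply: comonoid_eq; last first.
  apply: etrans (Arr_tens_counit _ _) (etrans _ (esym (Arr_tens_counit _ _))).
  by rewrite /= !Arr_tens_counit atensA.
apply: etrans (Arr_tens_comult _ _) (etrans _ (esym (Arr_tens_comult _ _))).
rewrite /= !Arr_tens_comult.
rewrite abraid_tensl abraid_tensr.
have -> : d X * (1_Y * s Y Z * 1_Z ∙ d Y * d Z) =
    1_X * 1_X * (1_Y * s Y Z * 1_Z) ∙ d X * (d Y * d Z).
  by rewrite -aid_tens -[RHS]atens_comp ?acomp1m; try endpoints.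
have -> : (1_X * s X Y * 1_Y ∙ d X * d Y) * d Z =
    1_X * s X Y * 1_Y * (1_Z * 1_Z) ∙ d X * d Y * d Z.
  by rewrite -aid_tens -[RHS]atens_comp ?acomp1m; try endpoints.
rewrite !acompA; try endpoints.
rewrite (atensA (d X)); congr acomp.
rewrite !aid_tens.
have -> : 1_X * 1_X * (1_Y * s Y Z * 1_Z) = 1_X * (1_X * 1_Y * s Y Z) * 1_Z.
  by rewrite !atensA.
have -> : 1_X * (1_Y * s X Z ∙ s X Y * 1_Z) * (1_Y * 1_Z) =
          1_X * ((1_Y * s X Z ∙ s X Y * 1_Z) * 1_Y) * 1_Z.
  by rewrite !atensA.
have -> : 1_X * 1_Y * (s X Z * 1_Y ∙ 1_X * s Y Z) * 1_Z =
          1_X * (1_Y * (s X Z * 1_Y ∙ 1_X * s Y Z)) * 1_Z.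
  by rewrite !atensA.
have -> : 1_X * s X Y * 1_Y * (1_Z * 1_Z) = 1_X * (s X Y * (1_Y * 1_Z)) * 1_Z.
  by rewrite !atensA.
rewrite !atens3_comp; try endpoints.
congr (_ * _ * _).
rewrite atens_compl ?atens_compr; try endpoints.
rewrite -!acompA; try endpoints.
rewrite -!atensA; congr acomp.
rewrite (atensA 1_X) (atensA 1_Y 1_X) -!aid_tens -!atens_comp; try endpoints.
by rewrite !acomp1m // !acompm1.
Qed.

Lemma Arr_comult_unit : d unit_comonoid = 1_𝟙.
Proof. exact: Arr_hcast. Qed.

Lemma tens_comonoid1l (X : comonoid C) : tens_comonoid unit_comonoid X = X.
Proof.
apply: comonoid_eq; last by apply: etrans (Arr_tens_counit _ _) _; exact: atens1l.
apply: etrans (Arr_tens_comult _ _) _; rewrite Arr_comult_unit /= abraid1l !atens1l.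
by rewrite -aid_tens acomp1m.
Qed.

Lemma tens_comonoid1r (X : comonoid C) : tens_comonoid X unit_comonoid = X.
Proof.
apply: comonoid_eq; last by apply: etrans (Arr_tens_counit _ _) _; exact: atens1r.
apply: etrans (Arr_tens_comult _ _) _; rewrite Arr_comult_unit /= abraid1r !atens1r.
by rewrite -aid_tens acomp1m.
Qed.

Lemma Arr_com (X Y X' Y' : com_category) (f : hom X Y) (g : hom X' Y') :
  X = X' -> Y = Y' -> Arr (sval f) = Arr (sval g) -> Arr f = Arr g.
Proof.
move=> eX eY; case: _ / eX g => g; case: _ / eY g => g /Arr_inj fg.
by congr Arr; apply: sval_inj.
Qed.

Definition com : monoidal.
Proof.
refine (@Monoidal com_category unit_comonoid tens_comonoid
  (fun X X' Y Y' f g => exist _ (sval f ⊗₁ sval g)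
     (tens_is_comonoid_hom (proj2_sig f) (proj2_sig g))) _ _ _ _ _ _ _ _).
- by move=> X Y; apply: sval_inj; apply: tensm_id.
- by move=> *; apply: sval_inj; apply: tensm_comp.
- exact: tens_comonoidA.
- exact: tens_comonoid1l.
- exact: tens_comonoid1r.
- by move=> *; apply: Arr_com; [exact: tens_comonoidA..|exact: tensmA].
- by move=> *; apply: Arr_com; [exact: tens_comonoid1l..|exact: tensm1l].
- by move=> *; apply: Arr_com; [exact: tens_comonoid1r..|exact: tensm1r].
Defined.

End Com.

(* For a comonoid X, its comultiplication is a morphism X -> X ⊗ X of C, and
   the comonoid X ⊗ X has carrier X ⊗ X; similarly for the counit. *)
Definition has_structure_maps (C : braided) (S : monoidal_subcat (com C)) :
    Prop :=
  forall X : com C, sub_ob S X ->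
    (exists f : hom X 𝟙, sval f = counit X /\ sub_hom S f) /\
    (exists f : hom X (X ⊗ X), sval f = comult X /\ sub_hom S f).

Section Cartesian.
Variable D : monoidal.

Definition to_unit (H : is_terminal (𝟙 : D)) (X : D) : hom X 𝟙 :=
  sval (cid (H X)).

Definition fst_proj (H : is_terminal (𝟙 : D)) (X Y : D) : hom (X ⊗ Y) X :=
  hcast erefl (tens1r X) (idm X ⊗₁ to_unit H Y).

Definition snd_proj (H : is_terminal (𝟙 : D)) (X Y : D) : hom (X ⊗ Y) Y :=
  hcast erefl (tens1l Y) (to_unit H X ⊗₁ idm Y).

Record is_cartesian : Prop := IsCartesian {
  unit_terminal : is_terminal (𝟙 : D);
  tens_product : forall X Y : D,
    is_product (fst_proj unit_terminal X Y) (snd_proj unit_terminal X Y)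
}.

Definition canonical_symmetry (H : is_cartesian) (X Y : D) :
    hom (X ⊗ Y) (Y ⊗ X) :=
  sval (cid (tens_product H (snd_proj (unit_terminal H) X Y)
                            (fst_proj (unit_terminal H) X Y))).

End Cartesian.

(* Main.v *)
(** If D is cartesian, its canonical symmetry is a braiding, each object carries
    exactly one comonoid structure (the diagonal), and each morphism is a comonoid
    morphism, so D is isomorphic to the whole of Com(D).
    Conversely, for comonoids X and Y and any braiding,
    (π¹ ⊗ π²) ∘ Δ_{X⊗Y} = id and (π² ⊗ π¹) ∘ Δ_{X⊗Y} = σ_{X,Y}.
    By the first identity a comonoid morphism k into X ⊗ Y equals
    (π¹k ⊗ π²k) ∘ Δ, so the pairing of f and g can only be (f ⊗ g) ∘ Δ, which is
    available because Δ lies in D. The second identity says that the canonical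
    symmetry is σ, and composing it with the comonoid morphism Δ_X (for Y = X)
    gives σ ∘ Δ = Δ, an Eckmann-Hilton argument. *)

From mathcomp Require Import ssreflect ssrfun boolp.
Require Import Defs.

Set Implicit Arguments.
Unset Strict Implicit.
Unset Printing Implicit Defensive.

Local Open Scope moncat_scope.

Local Notation "f * g" := (atens f g).
Local Notation "g ∙ f" := (acomp g f) (at level 45, left associativity).
Local Notation "1_ X" := (aid X) (at level 8, X at level 2, format "1_ X").
Local Notation d X := (Arr (comult X)).
Local Notation e X := (Arr (counit X)).

(** * The canonical symmetry of a cartesian category is a braiding *)

Section CartesianBraiding.
Variables (D : monoidal) (H : is_cartesian D).
Implicit Types (a b : arrow D) (X Y Z : D).

Let aunit X : arrow D := Arr (to_unit (unit_terminal H) X).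
Local Notation t X := (aunit X).

Lemma Arr_fst_proj X Y : Arr (fst_proj (unit_terminal H) X Y) = 1_X * t Y.
Proof. exact: Arr_hcast. Qed.

Lemma Arr_snd_proj X Y : Arr (snd_proj (unit_terminal H) X Y) = t X * 1_Y.
Proof. exact: Arr_hcast. Qed.

Lemma terminal_arrow a b :
  src a = src b -> tgt a = 𝟙 -> tgt b = 𝟙 -> a = b.
Proof.
case: a b => X U f [X' U' g] /= eX eU eU'.
case: _ / eX g => g; case: _ / (esym eU) f => f; case: _ / (esym eU') g => g.
have [h [_ hu]] := unit_terminal H X.
by rewrite -(hu f) // -(hu g).
Qed.

Lemma to_unit_comp a : t (tgt a) ∙ a = t (src a).
Proof. by apply: terminal_arrow; endpoints. Qed.

Lemma to_unit_tens X Y : t (X ⊗ Y) = t X * t Y.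
Proof. by apply: terminal_arrow; endpoints. Qed.

(** Uniqueness in the universal property, restated for arrows whose endpoints are only provably
    equal, as after reassociation. Equations into a tensor product are checked on their two
    components from here on. *)
Lemma proj_inj X Y a b : src a = src b -> tgt a = X ⊗ Y -> tgt b = X ⊗ Y ->
  1_X * t Y ∙ a = 1_X * t Y ∙ b -> t X * 1_Y ∙ a = t X * 1_Y ∙ b -> a = b.
Proof.
case: a b => Z U f [Z' U' g] /= eZ eU eU'.
case: _ / eZ g => g; case: _ / (esym eU) f => f; case: _ / (esym eU') g => g.
rewrite -Arr_fst_proj -Arr_snd_proj -!Arr_comp => /Arr_inj e1 /Arr_inj e2.
have [h [_ hu]] := tens_product H
  (fst_proj (unit_terminal H) X Y ∘ g) (snd_proj (unit_terminal H) X Y ∘ g).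
by rewrite -(hu f) // -(hu g).
Qed.

Lemma fst_nat a b : 1_(tgt a) * t (tgt b) ∙ a * b = a ∙ 1_(src a) * t (src b).
Proof.
rewrite -atens_comp // to_unit_comp acomp1m // -[X in _ = X ∙ _]atens1r.
by rewrite -atens_comp // acompm1 // acomp1m.
Qed.

Lemma snd_nat a b : t (tgt a) * 1_(tgt b) ∙ a * b = b ∙ t (src a) * 1_(src b).
Proof.
rewrite -atens_comp // to_unit_comp acomp1m // -[X in _ = X ∙ _]atens1l.
by rewrite -atens_comp // acompm1 // acomp1m.
Qed.

Definition sym_arrow X Y : arrow D := Arr (canonical_symmetry H X Y).
Local Notation s := sym_arrow.

Lemma fst_sym X Y : 1_Y * t X ∙ s X Y = t X * 1_Y.
Proof.
rewrite -Arr_fst_proj -Arr_snd_proj -Arr_comp; congr Arr.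
by rewrite /canonical_symmetry; case: cid => h [[]].
Qed.

Lemma snd_sym X Y : t Y * 1_X ∙ s X Y = 1_X * t Y.
Proof.
rewrite -Arr_fst_proj -Arr_snd_proj -Arr_comp; congr Arr.
by rewrite /canonical_symmetry; case: cid => h [[]].
Qed.

Lemma sym_sym X Y :
  canonical_symmetry H Y X ∘ canonical_symmetry H X Y = idm (X ⊗ Y).
Proof.
apply: Arr_inj; rewrite Arr_comp; apply: (@proj_inj X Y); try endpoints.
- by rewrite acompA // fst_sym snd_sym acompm1.
- by rewrite acompA // snd_sym fst_sym acompm1.
Qed.

Lemma sym_iso X Y : is_iso (canonical_symmetry H X Y).
Proof. by exists (canonical_symmetry H Y X); rewrite !sym_sym. Qed.

Lemma sym_nat X X' Y Y' (f : hom X X') (g : hom Y Y') :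
  canonical_symmetry H X' Y' ∘ (f ⊗₁ g) = (g ⊗₁ f) ∘ canonical_symmetry H X Y.
Proof.
have fn := fst_nat (Arr f) (Arr g); have sn := snd_nat (Arr f) (Arr g).
have fn' := fst_nat (Arr g) (Arr f); have sn' := snd_nat (Arr g) (Arr f).
rewrite /= in fn sn fn' sn'.
apply: Arr_inj; rewrite !Arr_comp !Arr_tens -!/(sym_arrow _ _).
apply: (@proj_inj Y' X'); try endpoints.
- by rewrite !acompA // fst_sym fn' sn -acompA ?fst_sym //; endpoints.
- by rewrite !acompA // snd_sym sn' fn -acompA ?snd_sym //; endpoints.
Qed.

(** Compare components. Splitting [t (X ⊗ Y)], respectively [1_(X ⊗ Y)], into tensor factors lets
    the projection cross one symmetry at a time. *)
Lemma sym_tensl X Y Z : s (X ⊗ Y) Z = (s X Z * 1_Y) ∙ (1_X * s Y Z).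
Proof.
apply: (@proj_inj Z (X ⊗ Y)); try endpoints.
- rewrite fst_sym acompA; try endpoints.
  rewrite to_unit_tens (atensA 1_Z) -atens_comp ?fst_sym ?acompm1; try endpoints.
  by rewrite -!atensA -atens_comp ?fst_sym ?acompm1.
- rewrite snd_sym acompA; try endpoints.
  rewrite aid_tens (atensA _ 1_X) -atens_comp ?snd_sym ?acomp1m; try endpoints.
  by rewrite -!atensA -atens_comp ?snd_sym ?acomp1m.
Qed.

Lemma sym_tensr X Y Z : s X (Y ⊗ Z) = (1_Y * s X Z) ∙ (s X Y * 1_Z).
Proof.
apply: (@proj_inj (Y ⊗ Z) X); try endpoints.
- rewrite fst_sym acompA; try endpoints.
  rewrite aid_tens -(atensA 1_Y) -atens_comp ?fst_sym ?acomp1m; try endpoints.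
  by rewrite !atensA -atens_comp ?fst_sym ?acomp1m.
- rewrite snd_sym acompA; try endpoints.
  rewrite to_unit_tens -(atensA (t Y)) -atens_comp ?snd_sym ?acompm1; try endpoints.
  by rewrite !atensA -atens_comp ?snd_sym ?acompm1.
Qed.

Definition cartesian_braided : braided.
Proof.
refine (@Braided D (canonical_symmetry H) sym_iso sym_nat _ _).
- by move=> X Y Z; rewrite Arr_comp Arr_hcast; apply: sym_tensl.
- by move=> X Y Z; rewrite Arr_comp Arr_hcast; apply: sym_tensr.
Defined.

(** * Comonoids in a cartesian category are diagonals *)

Lemma cartesian_counit (X : comonoid D) : e X = t X.
Proof. exact: terminal_arrow. Qed.

Lemma fst_comult (X : comonoid D) : 1_X * t X ∙ d X = 1_X.
Proof. by rewrite -cartesian_counit -Arr_tens -Arr_comp counit_r. Qed.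

Lemma snd_comult (X : comonoid D) : t X * 1_X ∙ d X = 1_X.
Proof. by rewrite -cartesian_counit -Arr_tens -Arr_comp counit_l. Qed.

(** Terminality forces the counit, and the counit laws then prescribe both components of the
    comultiplication. This supplies the strict equalities of objects required of a strict functor
    into comonoids. *)
Lemma comonoid_ob_inj (X Y : comonoid D) : carrier X = carrier Y -> X = Y.
Proof.
move=> eXY; apply: comonoid_eq; last by apply: terminal_arrow.
apply: (@proj_inj X X); rewrite /= -?eXY // ?fst_comult ?snd_comult eXY.
- by rewrite fst_comult.
- by rewrite snd_comult.
Qed.

(** Naturality of the projections shows that both composites into [Y ⊗ Y] have both components equal
    to [f]; the counit condition is terminality. *)
Lemma cartesian_comonoid_hom (X Y : comonoid D) (f : hom X Y) :
  is_comonoid_hom f.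
Proof.
split; apply: Arr_inj; last by apply: terminal_arrow.
have fn := fst_nat (Arr f) (Arr f); have sn := snd_nat (Arr f) (Arr f).
rewrite /= in fn sn.
rewrite !Arr_comp Arr_tens; apply: (@proj_inj Y Y); try endpoints.
- rewrite !acompA // fn fst_comult acomp1m //.
  by rewrite -acompA ?fst_comult ?acompm1 //; endpoints.
- rewrite !acompA // sn snd_comult acomp1m //.
  by rewrite -acompA ?snd_comult ?acompm1 //; endpoints.
Qed.

Lemma diagonal_exists X : exists f : hom X (X ⊗ X),
  1_X * t X ∙ Arr f = 1_X /\ t X * 1_X ∙ Arr f = 1_X.
Proof.
have [h [[h1 h2] _]] := tens_product H (idm X) (idm X).
by exists h; rewrite -Arr_fst_proj -Arr_snd_proj -!Arr_comp h1 h2.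
Qed.

Definition diagonal X : hom X (X ⊗ X) := sval (cid (diagonal_exists X)).

Lemma fst_diagonal X : 1_X * t X ∙ Arr (diagonal X) = 1_X.
Proof. by rewrite /diagonal; case: cid => f []. Qed.

Lemma snd_diagonal X : t X * 1_X ∙ Arr (diagonal X) = 1_X.
Proof. by rewrite /diagonal; case: cid => f []. Qed.

Definition cartesian_comonoid X : comonoid D.
Proof.
refine (@Comonoid D X (diagonal X) (to_unit (unit_terminal H) X) _ _ _).
- by rewrite Arr_comp; apply: fst_diagonal.
- by rewrite Arr_comp; apply: snd_diagonal.
have fn := fst_diagonal X; have sn := snd_diagonal X.
have tn : t (X ⊗ X) ∙ Arr (diagonal X) = t X by apply: (to_unit_comp (Arr _)).
(* Coassociativity: along [X ⊗ (X ⊗ X)] both sides have first component the identity and second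
   component the diagonal. *)
rewrite !Arr_comp !Arr_tens; apply: (@proj_inj X (X ⊗ X)); try endpoints.
- rewrite !acompA; try endpoints.
  rewrite -[in RHS]atens_comp // tn to_unit_tens atensA -atens_comp //.
  by rewrite fn !acomp1m // acompm1.
- rewrite !acompA; try endpoints.
  have := snd_nat 1_X (Arr (diagonal X)) => /= ->.
  rewrite -[in RHS]acompA ?sn ?acompm1; try endpoints.
  by rewrite aid_tens atensA -atens_comp // sn acomp1m // -aid_tens acomp1m.
Defined.

(** * The isomorphism of D with all comonoids in D *)

Definition full_subcat (M : monoidal) : monoidal_subcat M.
Proof.
by refine (@MonoidalSubcat M (fun _ => True) (fun _ _ _ => True) _ _ _ _ _ _ _).
Defined.

Local Notation Com := (subcat (full_subcat (com cartesian_braided))).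

Lemma Com_ob_inj (X Y : Com) :
  carrier (sval X) = carrier (sval Y) :> D -> X = Y.
Proof. by move=> eXY; apply: sval_inj; apply: comonoid_ob_inj. Qed.

Lemma Com_Arr (X Y X' Y' : Com) (f : hom X Y) (g : hom X' Y') :
  Arr (sval (sval f)) = Arr (sval (sval g)) :> arrow D -> Arr f = Arr g.
Proof.
move=> efg; apply: Arr_subcat; apply: Arr_com => //; apply: comonoid_ob_inj.
- by have := f_equal (@src D) efg.
- by have := f_equal (@tgt D) efg.
Qed.

Definition to_Com_ob X : Com := exist _ (cartesian_comonoid X) I.

Definition to_Com_hom X Y (f : hom X Y) : hom (to_Com_ob X) (to_Com_ob Y) :=
  exist _ (exist _ f (cartesian_comonoid_hom
    (X := cartesian_comonoid X) (Y := cartesian_comonoid Y) f)) I.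

Definition to_Com : monoidal_functor D Com.
Proof.
refine (@MonoidalFunctor D Com to_Com_ob to_Com_hom _ _ _ _ _).
- by move=> X; do 2!apply: sval_inj.
- by move=> X Y Z g f; do 2!apply: sval_inj.
- exact: Com_ob_inj.
- by move=> X Y; apply: Com_ob_inj.
- by move=> *; apply: Com_Arr.
Defined.

Definition of_Com : monoidal_functor Com D.
Proof.
by refine (@MonoidalFunctor Com D (fun X : Com => carrier (sval X))
  (fun (X Y : Com) f => sval (sval f)) _ _ _ _ _).
Defined.

Definition Com_iso : monoidal_iso D Com.
Proof.
refine (@MonoidalIso D Com to_Com of_Com _ _) => //.
by move=> X Y f; apply: Com_Arr.
Defined.

(** Structure maps are morphisms of D, hence comonoid morphisms, once their codomains are given the
    unit and tensor comonoid structures. *)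
Lemma Com_has_structure_maps :
  has_structure_maps (full_subcat (com cartesian_braided)).
Proof.
move=> X _; split.
- by exists (exist _ (counit X)
    (cartesian_comonoid_hom (Y := unit_comonoid cartesian_braided) _)).
- by exists (exist _ (comult X)
    (cartesian_comonoid_hom (Y := @tens_comonoid cartesian_braided X X) _)).
Qed.

End CartesianBraiding.

(** * Projections applied to the comultiplication of a tensor product *)

Section TensorComonoid.
Variable C : braided.
Implicit Types X Y : comonoid C.
Local Notation s := (@abraid C).

(** As the counit lands in the unit object, [a] can be applied after it, which leaves the counit law
    of [X]. *)
Lemma comult_counit_r (a : arrow C) X :
  src a = carrier X -> a * e X ∙ d X = a.
Proof.
move=> sa; have -> : a * e X = a ∙ 1_X * e X.
  by rewrite -{2}(atens1r a) -atens_comp // acompm1 // acomp1m.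
by rewrite -acompA ?aunit_r ?acompm1 //=; rewrite sa tens1r.
Qed.

Lemma comult_counit_l (a : arrow C) X :
  src a = carrier X -> e X * a ∙ d X = a.
Proof.
move=> sa; have -> : e X * a = a ∙ e X * 1_X.
  by rewrite -{2}(atens1l a) -atens_comp // acompm1 // acomp1m.
by rewrite -acompA ?aunit_l ?acompm1 //=; rewrite sa tens1l.
Qed.

Lemma tens_comult_fst_snd X Y :
  (1_X * e Y) * (e X * 1_Y) ∙ Arr (tens_comult X Y) = 1_(X ⊗ Y).
Proof.
rewrite Arr_tens_comult acompA; try endpoints.
have -> : 1_X * e Y * (e X * 1_Y) = 1_X * (e Y * e X) * 1_Y.
  by rewrite !atensA.
(* Naturality moves the braiding past the counits to [𝟙 ⊗ 𝟙], where it is the identity. *)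
have sn : e Y * e X ∙ s X Y = e X * e Y.
  have /= <- := abraid_nat (e X) (e Y).
  by rewrite abraid1l acomp1m //; endpoints.
rewrite atens3_comp ?sn ?acompm1; try endpoints.
have -> : 1_X * (e X * e Y) * 1_Y = 1_X * e X * (e Y * 1_Y).
  by rewrite !atensA.
by rewrite -atens_comp // aunit_r aunit_l -aid_tens.
Qed.

Lemma tens_comult_snd_fst X Y :
  (e X * 1_Y) * (1_X * e Y) ∙ Arr (tens_comult X Y) = s X Y.
Proof.
rewrite Arr_tens_comult acompA; try endpoints.
have -> : e X * 1_Y * (1_X * e Y) = e X * (1_Y * 1_X) * e Y.
  by rewrite !atensA.
rewrite -aid_tens atens3_comp ?acompm1 ?acomp1m; try endpoints.
(* The outer counits land in the unit object, so they may be applied before the middle braiding;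
   they then cancel against the comultiplications. *)
have -> : e X * s X Y * e Y = s X Y ∙ e X * 1_X * (1_Y * e Y).
  have -> : e X * 1_X * (1_Y * e Y) = e X * (1_X * 1_Y) * e Y.
    by rewrite !atensA.
  rewrite -[X in X ∙ _]atens1r -[X in X * _ ∙ _]atens1l -aid_tens.
  by rewrite atens3_comp ?acomp1m ?acompm1.
rewrite -acompA; try endpoints.
by rewrite -atens_comp // aunit_r aunit_l -aid_tens acompm1.
Qed.

End TensorComonoid.

(** * Subcategories of comonoids that contain their structure maps *)

Section ComonoidSubcategory.
Variables (C : braided) (S : monoidal_subcat (com C)) (D : monoidal).
Variables (F : monoidal_iso D (subcat S)) (HS : has_structure_maps S).
Local Notation s := (@abraid C).

Let cX (X : D) : comonoid C := sval (F X).
(* The morphism of C underlying f; equations between morphisms of D are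
   transported along U, which is injective on hom-sets. *)
Let U (X Y : D) (f : hom X Y) : arrow C := Arr (sval (sval (fhom F f))).

Lemma U_ob_unit : cX 𝟙 = unit_comonoid C.
Proof. by rewrite /cX fob_unit. Qed.

Lemma U_ob_tens (X Y : D) : cX (X ⊗ Y) = tens_comonoid (cX X) (cX Y).
Proof. by rewrite /cX fob_tens. Qed.

Lemma comult_ob_tens (X Y : D) :
  d (cX (X ⊗ Y)) = Arr (tens_comult (cX X) (cX Y)).
Proof. by rewrite U_ob_tens. Qed.

Lemma U_ob_tens_carrier (X Y : D) :
  carrier (cX (X ⊗ Y)) = carrier (cX X) ⊗ carrier (cX Y).
Proof. by rewrite U_ob_tens. Qed.

Lemma U_id (X : D) : U (idm X) = 1_(cX X).
Proof. by rewrite /U fhom_id. Qed.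

Lemma U_comp (X Y Z : D) (g : hom Y Z) (f : hom X Y) : U (g ∘ f) = U g ∙ U f.
Proof. by rewrite /U fhom_comp -Arr_comp. Qed.

Lemma U_Arr (X Y X' Y' : D) (f : hom X Y) (g : hom X' Y') :
  Arr f = Arr g -> U f = U g.
Proof.
pose V (a : arrow D) := U (mor a).
by move=> efg; apply: (f_equal V efg).
Qed.

Lemma U_tens (X X' Y Y' : D) (f : hom X X') (g : hom Y Y') :
  U (f ⊗₁ g) = U f * U g.
Proof.
pose V (a : arrow (subcat S)) : arrow C := Arr (sval (sval (mor a))).
exact: (f_equal V (fhom_tens F f g)).
Qed.

Lemma U_inj (X Y : D) (f g : hom X Y) : U f = U g -> f = g.
Proof.
move=> /Arr_inj efg; apply: Arr_inj.
rewrite -(iso_funK F f) -(iso_funK F g); congr (Arr (fhom _ _)).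
by do 2!apply: sval_inj.
Qed.

(** Lifts a morphism of [S] to D through the inverse functor. The endpoints are tied by equations
    because [cX 𝟙] and [cX (X ⊗ Y)] are only provably the unit and tensor comonoids. *)
Lemma U_full (X Y : D) (A B : com C) (h : hom A B) :
  A = cX X -> B = cX Y -> sub_hom S h -> exists f : hom X Y, U f = Arr (sval h).
Proof.
move=> eA eB; case: _ / (esym eA) h => h; case: _ / (esym eB) h => h Sh.
pose k : hom (F X) (F Y) := exist _ h Sh.
(* The inverse law is stated on arrows; reading off the source at an identity gives it on
   objects. *)
have eX Z : iso_inv F (F Z) = Z.
  by have := f_equal (@src D) (iso_funK F (idm Z)).
exists (hcast (eX X) (eX Y) (fhom (iso_inv F) k)).
rewrite (U_Arr (Arr_hcast _ _ _)).
pose V (a : arrow (subcat S)) : arrow C := Arr (sval (sval (mor a))).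
exact: (f_equal V (iso_invK F k)).
Qed.

Lemma U_comult (X Y : D) (f : hom X Y) :
  d (cX Y) ∙ U f = U f * U f ∙ d (cX X).
Proof.
have [fd _] := proj2_sig (sval (fhom F f)).
by rewrite /U -Arr_tens -!Arr_comp; congr Arr.
Qed.

Lemma U_counit (X Y : D) (f : hom X Y) : e (cX Y) ∙ U f = e (cX X).
Proof.
have [_ fe] := proj2_sig (sval (fhom F f)).
by rewrite /U -!Arr_comp; congr Arr.
Qed.

Lemma counit_lift (X : D) : exists f : hom X 𝟙, U f = e (cX X).
Proof.
have [[f [<- Sf]] _] := HS (proj2_sig (F X)).
by apply: U_full Sf; rewrite ?U_ob_unit.
Qed.

Lemma comult_lift (X : D) : exists f : hom X (X ⊗ X), U f = d (cX X).
Proof.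
have [_ [f [<- Sf]]] := HS (proj2_sig (F X)).
by apply: U_full Sf; rewrite ?U_ob_tens.
Qed.

(** A comonoid morphism preserves counits, and the counit of the unit comonoid is the identity.
    Hence the uniqueness half of terminality. *)
Lemma U_to_unit (X : D) (f : hom X 𝟙) : U f = e (cX X).
Proof.
rewrite -(U_counit f) U_ob_unit acomp1m //.
by rewrite -[RHS]/(carrier (unit_comonoid C)) -U_ob_unit.
Qed.

Lemma sub_unit_terminal : is_terminal (𝟙 : D).
Proof.
move=> X; have [f Uf] := counit_lift X; exists f; split=> // g _.
by apply: U_inj; rewrite !U_to_unit.
Qed.

Section Projections.
Variable T : is_terminal (𝟙 : D).

Lemma U_fst_proj (X Y : D) : U (fst_proj T X Y) = 1_(cX X) * e (cX Y).
Proof. by rewrite (U_Arr (Arr_hcast _ _ _)) U_tens U_id U_to_unit. Qed.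

Lemma U_snd_proj (X Y : D) : U (snd_proj T X Y) = e (cX X) * 1_(cX Y).
Proof. by rewrite (U_Arr (Arr_hcast _ _ _)) U_tens U_id U_to_unit. Qed.

Lemma U_pair (X Y Z : D) (k : hom Z (X ⊗ Y)) :
  U k = U (fst_proj T X Y ∘ k) * U (snd_proj T X Y ∘ k) ∙ d (cX Z).
Proof.
rewrite !U_comp atens_comp /= ?U_ob_tens_carrier //.
rewrite -acompA ?U_fst_proj ?U_snd_proj /= ?U_ob_tens_carrier //.
(* Since [k] preserves comultiplication, [k ⊗ k] after the comultiplication of [Z] becomes the
   comultiplication of [X ⊗ Y] after [k]. *)
rewrite -U_comult comult_ob_tens acompA /= ?U_ob_tens_carrier //.
by rewrite tens_comult_fst_snd acomp1m //= U_ob_tens_carrier.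
Qed.

Lemma sub_tens_product (X Y : D) : is_product (fst_proj T X Y) (snd_proj T X Y).
Proof.
move=> Z f g; have [dl Ud] := comult_lift Z.
(* Each projection of the pairing erases one of [f] and [g] by counit preservation, leaving a counit
   that cancels against the comultiplication of [Z]. *)
have [Ucf Ucg] := (U_counit f, U_counit g).
exists ((f ⊗₁ g) ∘ dl); split; last first.
  by move=> k [kf kg]; apply: U_inj; rewrite (U_pair k) kf kg U_comp U_tens Ud.
have Uh : U ((f ⊗₁ g) ∘ dl) = U f * U g ∙ d (cX Z) by rewrite U_comp U_tens Ud.
split; apply: U_inj; rewrite U_comp Uh.
- rewrite U_fst_proj acompA // -atens_comp // Ucg acomp1m //.
  exact: comult_counit_r.
- rewrite U_snd_proj acompA // -atens_comp // Ucf acomp1m //.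
  exact: comult_counit_l.
Qed.

End Projections.

Lemma sub_cartesian : is_cartesian D.
Proof. by exists sub_unit_terminal; apply: sub_tens_product. Qed.

Lemma U_canonical_symmetry (H : is_cartesian D) (X Y : D) :
  U (canonical_symmetry H X Y) = s (cX X) (cX Y).
Proof.
have [k1 k2] : fst_proj (unit_terminal H) Y X ∘ canonical_symmetry H X Y =
                 snd_proj (unit_terminal H) X Y /\
               snd_proj (unit_terminal H) Y X ∘ canonical_symmetry H X Y =
                 fst_proj (unit_terminal H) X Y.
  by rewrite /canonical_symmetry; case: cid => k [].
rewrite (U_pair (unit_terminal H) (canonical_symmetry H X Y)) k1 k2.
by rewrite U_snd_proj U_fst_proj comult_ob_tens tens_comult_snd_fst.
Qed.

Lemma sub_cocommutative (X : D) : cocommutative (cX X).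
Proof.
apply: Arr_inj; rewrite Arr_comp; have [dl Ud] := comult_lift X.
(* The comultiplication lies in D, so it is itself a comonoid morphism from [cX X] to its tensor
   square. *)
have := U_comult dl; rewrite Ud comult_ob_tens => dd.
(* With the braiding written as the swapped projections after the comultiplication of the square,
   [dd] brings each projection onto its own copy of the comultiplication, where a counit law removes
   it. *)
rewrite -[Arr (braid _ _)]tens_comult_snd_fst -acompA; try endpoints.
rewrite dd acompA; try endpoints.
rewrite -atens_comp ?aunit_l ?aunit_r; try endpoints.
by rewrite -aid_tens acomp1m.
Qed.

End ComonoidSubcategory.

Theorem theorem1p2 (D : monoidal) :
  (is_cartesian D <->
   exists (C : braided) (S : monoidal_subcat (com C)),
     inhabited (monoidal_iso D (subcat S)) /\ has_structure_maps S) /\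
  (forall (C : braided) (S : monoidal_subcat (com C))
      (F : monoidal_iso D (subcat S)),
    has_structure_maps S ->
    (forall (H : is_cartesian D) (X Y : D),
       Arr (proj1_sig (proj1_sig (fhom F (canonical_symmetry H X Y)))) =
       Arr (braid (carrier (proj1_sig (F X))) (carrier (proj1_sig (F Y))))) /\
    (forall X : D, cocommutative (proj1_sig (F X)))).
Proof.
split; [split|].
- move=> H; exists (cartesian_braided H), (full_subcat _).
  by split; [exists; apply: Com_iso|apply: Com_has_structure_maps].
- by move=> [C [S [[F] HS]]]; apply: sub_cartesian F HS.
- move=> C S F HS; split; last exact: sub_cocommutative.
  exact: U_canonical_symmetry.
Qed.
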